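(* $f(m)=\Theta(m^2)$ as $m\to\infty$; that is, there exist constants $c,C>0$ and an integer $m_0$ such that $c\,m^2\leq f(m)\leq C\,m^2$ for all integers $m\geq m_0$.
   Context: Graphs are finite, simple and undirected. $\lambda(G)$ is the spectral radius of $G$, i.e. the largest eigenvalue of its adjacency matrix. $f(m)$ is the minimum number of copies of 4-cycles (not necessarily induced subgraphs isomorphic to $C_4$) over all (labelled) graphs $G$ with exactly $m$ edges and $\lambda(G)>\sqrt{m}$. *)

(* Defs.v *)
From mathcomp Require Import all_boot all_order all_algebra.
From mathcomp Require Import boolp classical_sets reals.

Set Implicit Arguments.
Unset Strict Implicit.
Unset Printing Implicit Defensive.

Import Order.TTheory GRing.Theory Num.Theory.
Local Open Scope ring_scope.

Record sgraph := SGraph {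
  vertex :> finType;
  adj : rel vertex;
  adj_sym : symmetric adj;
  adj_irrefl : irreflexive adj }.

Definition edges (G : sgraph) : {set {set G}} :=
  [set [set p.1; p.2] | p : G * G & adj p.1 p.2].

Definition adjacency_matrix (R : realType) (G : sgraph) : 'M[R]_#|G| :=
  \matrix_(i, j) (adj (enum_val i) (enum_val j))%:R.

Definition is_largest_eigenvalue (R : realType) (n : nat) (A : 'M[R]_n)
    (a : R) : Prop :=
  eigenvalue A a /\ forall b : R, eigenvalue A b -> b <= a.

(* The default value 0 is reached only by the graph without vertices: the
   adjacency matrix of any other graph is real symmetric of positive size, so
   it has a largest eigenvalue. *)
Definition spectral_radius (R : realType) (G : sgraph) : R :=
  xget 0 [set a | is_largest_eigenvalue (adjacency_matrix R G) a]%classic.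

(* A copy of C4 has no isolated vertex, so it is determined by its edge set.
   The eight closed walks x0, x1, x2, x3 around one copy give the same edge
   set, so each copy, induced or not, is counted once. *)
Definition C4_copies (G : sgraph) : {set {set {set G}}} :=
  [set [set [set x; next t x] | x in val t]
    | t : 4.-tuple G & ucycleb (@adj G) t].

Definition C4_count_attained (R : realType) (m k : nat) : Prop :=
  exists G : sgraph,
    [/\ #|edges G| = m,
        Num.sqrt (m%:R : R) < spectral_radius R G
      & #|C4_copies G| = k].

(* The default value 0 is taken when no graph with m edges has spectral radius
   greater than the square root of m. A positive lower bound on
   min_C4_count R m thus implies that the minimum exists. *)
Definition min_C4_count (R : realType) (m : nat) : nat :=
  xget 0%N [set k | C4_count_attained R m k /\
    forall j : nat, C4_count_attained R m j -> (k <= j)%N]%classic.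

(* Main.v *)
Require Import Defs.
From mathcomp Require Import all_boot all_order all_algebra.
From mathcomp Require Import boolp classical_sets reals.
From mathcomp Require Import zify ring lra.

Set Implicit Arguments.
Unset Strict Implicit.
Unset Printing Implicit Defensive.

Import Order.TTheory GRing.Theory Num.Theory.
Local Open Scope ring_scope.

(** A copy of C4 is determined by two opposite edges and their orientations,
    so a graph with m edges has at most (2m)^2 copies. For the upper bound it
    remains to see that some graph with m edges has spectral radius greater
    than sqrt m: write m = k(k-1)/2 + r with r < k and take a clique on k
    vertices together with r disjoint edges, which has the eigenvalue k - 1.

    For the lower bound, let A be the adjacency matrix of a graph with m edges
    and lam an eigenvalue with lam > sqrt m. Let Q be the number of labelled
    4-cycles, and W the number of closed walks of length 4, that is, the sum
    of the squared entries of A^2. Cauchy-Schwarz alone gives lam^4 <= W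
    ([eigen_closed4]), and W <= Q + 2 sum deg^2 ([closed4_le]). When all
    degrees are at most 2m/5, the vertices of degree above m/25 number at most
    50, so that their degrees add up to little more than m; hence
    2 sum deg^2 < 0.97 m^2 for large m ([sum_sqr_deg_le]), and Q is of
    order m^2.

    Otherwise let u be a vertex of maximum degree d > 2m/5, with neighbourhood
    N, and let B be the adjacency matrix of the graph obtained by deleting the
    edges at u, which has k = m - d edges. Since k <= 3m/5, the same estimates
    show that either Q is of order m^2 or <f, Bf> <= (24/25) lam <f, f> for
    all f ([rayleigh_le]).
    Normalise the eigenvector to 1 at u. Its restriction y to the other
    vertices satisfies lam y = 1_N + By, and substituting this equation into
    itself yields
      lam^2 = d + <1_N, B 1_N> / lam + <B 1_N, z>,   z = y - 1_N / lam.
    The entries of B 1_N are bounded by the codegrees of u. If one of these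
    exceeds lam^2/100 > m/100, then that pair of vertices alone gives order m^2
    labelled 4-cycles. If none does, both correction terms are at most k/2, so
    lam^2 <= d + k = m ([isolate_eigenvalue_le]), a contradiction. *)

(** * Quadratic forms of adjacency relations *)

(** The standard inner product of real functions on the vertices. *)
Definition dot (R : realFieldType) (V : finType) (f g : V -> R) : R :=
  \sum_v f v * g v.

Lemma dotC (R : realFieldType) (V : finType) (f g : V -> R) :
  dot f g = dot g f.
Proof. by apply: eq_bigr => v _; rewrite mulrC. Qed.

Lemma dot_ge0 (R : realFieldType) (V : finType) (f : V -> R) : 0 <= dot f f.
Proof. by apply: sumr_ge0 => v _; rewrite -expr2 sqr_ge0. Qed.

Lemma dot_gt0 (R : realFieldType) (V : finType) (f : V -> R) (v : V) :
  f v != 0 -> 0 < dot f f.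
Proof.
move=> fv0; rewrite /dot (bigD1 v) //=; apply: ltr_wpDr.
  by apply: sumr_ge0 => w _; rewrite -expr2 sqr_ge0.
by rewrite -expr2 exprn_even_gt0.
Qed.

Lemma dot_linr (R : realFieldType) (V : finType) (f g h : V -> R) (a b : R) :
  dot f (fun v => a * g v + b * h v) = a * dot f g + b * dot f h.
Proof.
rewrite /dot !mulr_sumr -big_split; apply: eq_bigr => v _ /=; ring.
Qed.

Lemma Cauchy_Schwarz (R : realFieldType) (V : finType) (f g : V -> R) :
  dot f g ^+ 2 <= dot f f * dot g g.
Proof.
have : 0 <= \sum_v \sum_w (f v * g w - f w * g v) ^+ 2.
  by apply: sumr_ge0 => v _; apply: sumr_ge0 => w _; rewrite sqr_ge0.
suff -> : \sum_v \sum_w (f v * g w - f w * g v) ^+ 2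
    = dot f f * dot g g *+ 2 - dot f g ^+ 2 *+ 2.
  by rewrite subr_ge0 lerMn2r.
have prod (a b c d : V -> R) :
    dot a b * dot c d = \sum_v \sum_w a v * b v * (c w * d w).
  by rewrite mulr_suml; apply: eq_bigr => v _; rewrite mulr_sumr.
have -> : dot f f * dot g g *+ 2 - dot f g ^+ 2 *+ 2 = dot f f * dot g g
    + dot g g * dot f f + dot (fun v => - 2 * f v) g * dot f g.
  have -> : dot (fun v => - 2 * f v) g = - 2 * dot f g.
    by rewrite /dot mulr_sumr; apply: eq_bigr => v _; rewrite mulrA.
  by ring.
rewrite !prod -!big_split; apply: eq_bigr => v _; rewrite -!big_split.
by apply: eq_bigr => w _ /=; ring.
Qed.

(** The action of the adjacency matrix of [e] on functions on the vertices. *)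
Definition adjop (R : realFieldType) (V : finType) (e : rel V) (f : V -> R)
  : V -> R := fun v => \sum_w (e v w)%:R * f w.

Lemma adjop_selfadj (R : realFieldType) (V : finType) (e : rel V)
  (f g : V -> R) : symmetric e -> dot f (adjop e g) = dot (adjop e f) g.
Proof.
move=> e_sym; rewrite /dot /adjop.
under eq_bigr do rewrite mulr_sumr.
rewrite exchange_big; apply: eq_bigr => v _ /=; rewrite mulr_suml.
by apply: eq_bigr => w _; rewrite e_sym; ring.
Qed.

Lemma adjop_lin (R : realFieldType) (V : finType) (e : rel V)
  (f g : V -> R) (a b : R) (v : V) :
  adjop e (fun w => a * f w + b * g w) v = a * adjop e f v + b * adjop e g v.
Proof.
by rewrite /adjop !mulr_sumr -big_split; apply: eq_bigr => w _ /=; ring.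
Qed.

(** The number of neighbours of [v]. *)
Definition deg (V : finType) (e : rel V) (v : V) : nat :=
  (\sum_w e v w)%N.

(** The number of common neighbours of [v] and [w], when [e] is symmetric. *)
Definition codeg (V : finType) (e : rel V) (v w : V) : nat :=
  (\sum_z e v z * e w z)%N.

(** The sum of the squared entries of the square of the adjacency matrix. For a
    symmetric relation this is the number of closed walks of length 4. *)
Definition closed4 (V : finType) (e : rel V) : nat :=
  (\sum_v \sum_w codeg e v w ^ 2)%N.

Lemma adjop2E (R : realFieldType) (V : finType) (e : rel V) (f : V -> R) v :
  symmetric e -> adjop e (adjop e f) v = \sum_w (codeg e v w)%:R * f w.
Proof.
move=> e_sym; rewrite /adjop.
under eq_bigr do rewrite mulr_sumr.
rewrite exchange_big; apply: eq_bigr => w _ /=; rewrite natr_sum mulr_suml.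
by apply: eq_bigr => z _; rewrite natrM (e_sym w z); ring.
Qed.

(** The form is bounded by the Frobenius norm of the squared adjacency matrix:
    three applications of Cauchy-Schwarz replace the spectral theorem. *)
Lemma adjop_quartic (R : realFieldType) (V : finType) (e : rel V)
  (f : V -> R) : symmetric e ->
  dot f (adjop e f) ^+ 4 <= dot f f ^+ 4 * (closed4 e)%:R.
Proof.
move=> e_sym; set g := adjop e f.
have H1 := Cauchy_Schwarz f g.
have H2 := Cauchy_Schwarz f (adjop e g).
rewrite adjop_selfadj // -/g in H2.
have H3 : dot (adjop e g) (adjop e g) <= dot f f * (closed4 e)%:R.
  rewrite mulrC /closed4 natr_sum mulr_suml; apply: ler_sum => v _.
  rewrite -expr2 adjop2E //.
  apply: le_trans (Cauchy_Schwarz (fun w => (codeg e v w)%:R) f) _.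
  apply: ler_wpM2r; first exact: dot_ge0.
  by rewrite /dot natr_sum; apply: ler_sum => w _; rewrite natrX expr2.
have n0 := dot_ge0 f.
have p0 := dot_ge0 g.
move: H1 H2 H3 n0 p0.
move: (dot (adjop e g) _) (dot f g) (dot f f) (dot g g) (closed4 e)%:R.
move=> q a n p W H1 H2 H3 n0 p0.
have -> : a ^+ 4 = (a ^+ 2) ^+ 2 by rewrite -exprM.
apply: (@le_trans _ _ ((n * p) ^+ 2)).
  by rewrite lerXn2r // nnegrE ?sqr_ge0 ?mulr_ge0.
rewrite exprMn.
apply: (@le_trans _ _ (n ^+ 2 * (n * q))); first by rewrite ler_wpM2l ?sqr_ge0.
rewrite (_ : n ^+ 4 * W = n ^+ 2 * (n * (n * W))); last by ring.
by rewrite ler_wpM2l ?sqr_ge0 // ler_wpM2l.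
Qed.

Lemma rayleigh_le (R : realFieldType) (V : finType) (e : rel V)
  (f : V -> R) (mu : R) : symmetric e -> 0 <= mu ->
  (closed4 e)%:R <= mu ^+ 4 -> dot f (adjop e f) <= mu * dot f f.
Proof.
move=> e_sym mu0 Wmu; have n0 := dot_ge0 f.
have [a0|/ltW a0] := lerP 0 (dot f (adjop e f)); last first.
  by apply: le_trans a0 _; apply: mulr_ge0.
rewrite -(@ler_pXn2r _ 4) // ?nnegrE ?mulr_ge0 //.
apply: le_trans (adjop_quartic _ e_sym) _.
by rewrite exprMn mulrC ler_wpM2r // exprn_ge0.
Qed.

Lemma eigen_closed4 (R : realFieldType) (V : finType) (e : rel V)
  (f : V -> R) (lam : R) (v : V) : symmetric e -> f v != 0 ->
  (forall w, adjop e f w = lam * f w) -> lam ^+ 4 <= (closed4 e)%:R.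
Proof.
move=> e_sym fv eig; have n0 := dot_gt0 fv.
have := adjop_quartic f e_sym.
have -> : dot f (adjop e f) = dot f f * lam.
  rewrite /dot mulr_suml; apply: eq_bigr => w _; rewrite eig; ring.
by rewrite exprMn ler_pM2l // exprn_gt0.
Qed.

(** * Counting closed walks and 4-cycles *)

(** The labelled 4-cycles v, z, w, t of a symmetric irreflexive relation, encoded
    as ((v, w), (z, t)): the two pairs of opposite vertices are grouped. *)
Definition quads (V : finType) (e : rel V) : {set (V * V) * (V * V)} :=
  [set q | [&& e q.1.1 q.2.1, e q.1.2 q.2.1, e q.1.1 q.2.2, e q.1.2 q.2.2,
               q.1.1 != q.1.2 & q.2.1 != q.2.2]].

Lemma card_quads (V : finType) (e : rel V) :
  #|quads e| = (\sum_v \sum_w \sum_z \sum_t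
   [&& e v z, e w z, e v t, e w t, v != w & z != t])%N.
Proof.
rewrite pair_bigA /=.
under eq_bigr do rewrite pair_bigA /=.
rewrite pair_bigA /= -sum1_card big_mkcond; apply: eq_bigr => q _.
by rewrite inE; case: ifP.
Qed.

(** A closed walk v, z, w, t of length 4 is a labelled 4-cycle unless v = w or
    z = t, and each of these degenerate cases accounts for the sum of the
    squared degrees. *)
Lemma closed4_le (V : finType) (e : rel V) : symmetric e ->
  (closed4 e <= #|quads e| + 2 * \sum_v deg e v ^ 2)%N.
Proof.
move=> e_sym; rewrite card_quads.
have sq (V' : finType) (F : V' -> nat) :
    ((\sum_z F z) ^ 2 = \sum_z \sum_t F z * F t)%N.
  by rewrite -mulnn big_distrl; apply: eq_bigr => z _; rewrite big_distrr.
have D1 : (\sum_v deg e v ^ 2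
    = \sum_v \sum_w \sum_z \sum_t (v == w) * (e v z * e v t))%N.
  apply: eq_bigr => v _; rewrite (bigD1 v) //= [X in _ = (_ + X)%N]big1.
    rewrite addn0 /deg sq; apply: eq_bigr => z _; apply: eq_bigr => t _.
    by rewrite eqxx mul1n.
  move=> w /negPf wv; rewrite big1 // => z _; rewrite big1 // => t _.
  by rewrite eq_sym wv.
have D2 : (\sum_v deg e v ^ 2
    = \sum_v \sum_w \sum_z \sum_t (z == t) * (e v z * e w z))%N.
  under [RHS]eq_bigr => v _.
    rewrite exchange_big /=; over.
  rewrite exchange_big /=; apply: eq_bigr => z _; rewrite /deg sq.
  apply: eq_bigr => v _; apply: eq_bigr => w _.
  rewrite (bigD1 z) //= eqxx mul1n big1 ?addn0 ?(e_sym z) //.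
  by move=> t /negPf tz; rewrite eq_sym tz.
rewrite mul2n -addnn {1}D1 D2 /closed4 addnA -!big_split; apply: leq_sum => v _.
rewrite -!big_split; apply: leq_sum => w _; rewrite /codeg sq -!big_split.
apply: leq_sum => z _; rewrite -!big_split; apply: leq_sum => t _ /=.
case: (eqVneq v w) => [<-|vw]; case: (eqVneq z t) => [<-|zt] /=;
  by do 2?[case: (e v _)]; do 2?[case: (e w _)].
Qed.

(** Edges inside [H] are counted twice by the degrees in [H], those leaving [H]
    only once. *)
Lemma sum_deg_in (V : finType) (e : rel V) (H : {set V}) : symmetric e ->
  (2 * \sum_(v in H) deg e v
    <= \sum_v deg e v + \sum_(v in H) \sum_(w in H) e v w)%N.
Proof.
move=> e_sym.
have split v : deg e v = (\sum_(w in H) e v w + \sum_(w in ~: H) e v w)%N.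
  rewrite /deg (bigID (mem H)) /=; congr (_ + _)%N.
  by apply: eq_bigl => w; rewrite inE.
have cross : (\sum_(v in H) \sum_(w in ~: H) e v w
    <= \sum_(v in ~: H) deg e v)%N.
  rewrite exchange_big; apply: leq_sum => w _ /=.
  rewrite split; apply: leq_trans (leq_addr _ _).
  by apply: leq_sum => v _; rewrite e_sym.
rewrite [X in (_ <= X + _)%N](bigID (mem H)) /=.
have -> : (\sum_(i | i \notin H) deg e i = \sum_(v in ~: H) deg e v)%N.
  by apply: eq_bigl => w; rewrite inE.
have : (\sum_(v in H) deg e v = \sum_(v in H) \sum_(w in H) e v w
   + \sum_(v in H) \sum_(w in ~: H) e v w)%N.
  by rewrite -big_split; apply: eq_bigr => v _; rewrite split.
lia.
Qed.

Lemma deg_le_half (V : finType) (e : rel V) (k : nat) (v : V) :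
  symmetric e -> irreflexive e -> (\sum_v deg e v = 2 * k)%N ->
  (deg e v <= k)%N.
Proof.
move=> e_sym e_irr ek; have := sum_deg_in [set v] e_sym.
rewrite !big_set1 e_irr ek; lia.
Qed.

(** The threshold [h] separates high degrees from low ones. Fewer than [c.+1]
    vertices have degree above [h], so their degrees sum to at most
    [k + c ^ 2] instead of the trivial bound [2 * k], [k] being the number of
    edges. This factor 2 is what the main argument needs. *)
Lemma sum_sqr_deg_le (V : finType) (e : rel V) (k D h c : nat) :
  symmetric e -> (\sum_v deg e v = 2 * k)%N ->
  (forall v, (deg e v <= D)%N) -> (2 * k < h.+1 * c.+1)%N ->
  (\sum_v deg e v ^ 2 <= D * (k + c ^ 2) + h * (2 * k))%N.
Proof.
move=> e_sym ek degD hc; pose H := [set v | (h < deg e v)%N].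
have sub_deg (P : pred V) : (\sum_(v | P v) deg e v <= 2 * k)%N.
  by rewrite -ek [X in (_ <= X)%N](bigID P) leq_addr.
have cardH : (#|H| <= c)%N.
  have : (#|H| * h.+1 <= 2 * k)%N.
    apply: leq_trans (sub_deg (mem H)); rewrite -sum_nat_const.
    by apply: leq_sum => v; rewrite inE.
  move=> le1; have := leq_ltn_trans le1 hc.
  by rewrite mulnC ltn_pmul2l.
have degH : (\sum_(v in H) deg e v <= k + c ^ 2)%N.
  have := sum_deg_in H e_sym; rewrite ek.
  have : (\sum_(v in H) \sum_(w in H) e v w <= c ^ 2)%N.
    apply: (@leq_trans (\sum_(v in H) \sum_(w in H) 1)%N).
      by apply: leq_sum => v _; apply: leq_sum => w _; case: (e v w).
    by rewrite !sum_nat_const muln1 -mulnn leq_mul.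
  nia.
rewrite (bigID (mem H)) /=; apply: leq_add.
  apply: (@leq_trans (\sum_(v in H) D * deg e v)%N).
    by apply: leq_sum => v _; rewrite -mulnn leq_mul.
  by rewrite -big_distrr leq_mul.
apply: (@leq_trans (\sum_(v | v \notin H) h * deg e v)%N).
  by apply: leq_sum => v; rewrite inE -leqNgt -mulnn => ?; rewrite leq_mul.
by rewrite -big_distrr leq_mul.
Qed.

Lemma codeg_quads (V : finType) (e : rel V) (u v : V) : u != v ->
  (codeg e u v * (codeg e u v).-1 <= #|quads e|)%N.
Proof.
move=> uv; pose N := [set z | e u z && e v z].
have -> : codeg e u v = #|N|.
  rewrite -sum1_card big_mkcond; apply: eq_bigr => z _.
  by rewrite inE; case: (e u z); case: (e v z).
pose D := [set p in finset.setX N N | p.1 != p.2].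
have cardD : (#|N| * #|N|.-1 <= #|D|)%N.
  rewrite -!subn1 mulnBr muln1 -cardsX.
  rewrite leq_subLR -(cardsID [set p | p.1 != p.2] (finset.setX N N)) addnC.
  rewrite [(#|_ :\: _|)](_ : _ = #|[set (z, z) | z in N]|).
    apply: leq_add; first exact: leq_imset_card.
    by apply: subset_leq_card; apply/fintype.subsetP => p; rewrite !inE.
  apply: eq_card => -[a b]; rewrite !inE /= negbK.
  apply/idP/imsetP => [/and3P[/eqP <- aN _]|[z zN [-> ->]]].
    by exists a; rewrite // inE.
  by move: zN; rewrite inE eqxx => ->.
apply: leq_trans cardD _.
have inj : injective (fun p : V * V => ((u, v), p)) by move=> ? ? [].
rewrite -(card_imset _ inj); apply: subset_leq_card.
apply/fintype.subsetP => q /imsetP[[a b] abD ->]; move: abD.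
rewrite !inE /= uv /=.
by move=> /andP[/andP[/andP[-> ->] /andP[-> ->]] ->].
Qed.

(** * Deleting the edges at a vertex *)

(** The relation [e] with the edges at [u] deleted; [u] stays as a vertex. *)
Definition isolate (V : finType) (e : rel V) (u : V) : rel V :=
  fun v w => [&& e v w, v != u & w != u].

Lemma isolate_sym (V : finType) (e : rel V) (u : V) :
  symmetric e -> symmetric (isolate e u).
Proof. by move=> e_sym v w; rewrite /isolate e_sym [(v != u) && _]andbC. Qed.

Lemma isolate_irrefl (V : finType) (e : rel V) (u : V) :
  irreflexive e -> irreflexive (isolate e u).
Proof. by move=> e_irr v; rewrite /isolate e_irr. Qed.

Lemma sum_deg_isolate (V : finType) (e : rel V) (u : V) :
  symmetric e -> irreflexive e ->
  (\sum_v deg e v = \sum_v deg (isolate e u) v + 2 * deg e u)%N.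
Proof.
move=> e_sym e_irr; rewrite mul2n -addnn addnA /deg.
have row : (\sum_w e u w = \sum_v \sum_w (v == u) * e u w)%N.
  rewrite [RHS](bigD1 u) //= [X in (_ + X)%N]big1; last first.
    by move=> v /negPf ->; rewrite big1.
  by rewrite addn0; apply: eq_bigr => w _; rewrite eqxx mul1n.
have col : (\sum_w e u w = \sum_v \sum_w (w == u) * e u v)%N.
  apply: eq_bigr => v _; rewrite (bigD1 u) //= eqxx mul1n big1 ?addn0 //.
  by move=> w /negPf ->.
rewrite {1}row col -!big_split; apply: eq_bigr => v _.
rewrite -!big_split; apply: eq_bigr => w _ /=; rewrite /isolate.
case: (eqVneq v u) => [->|vu]; case: (eqVneq w u) => [->|wu] /=.
- by rewrite e_irr.
- by rewrite andbF mul1n mul0n addn0.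
- by rewrite andbF e_sym mul1n.
- by rewrite !andbT !addn0.
Qed.

Lemma quads_isolate (V : finType) (e : rel V) (u : V) :
  (#|quads (isolate e u)| <= #|quads e|)%N.
Proof.
apply: subset_leq_card; apply/fintype.subsetP => q; rewrite !inE.
by move=> /and5P[/andP[-> _] /andP[-> _] /andP[-> _] /andP[-> _] ->].
Qed.

(** Here [lam] is to be an eigenvalue of [e], and [closed4_e'] makes the
    quadratic form of [e'] at most [beta * lam], with [beta < 1]. *)
Section Isolate.
Variables (R : realFieldType) (V : finType) (e : rel V) (u : V) (lam beta : R).
Variable k : nat.
Hypotheses (e_sym : symmetric e) (e_irr : irreflexive e).
Let e' := isolate e u.
Hypotheses (lam4 : 4 <= lam) (beta0 : 0 <= beta) (beta1 : beta < 1).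
Hypothesis closed4_e' : (closed4 e')%:R <= (beta * lam) ^+ 4.

(* The indicator function of the neighbourhood of u and its image under e'. *)
Let one : V -> R := fun v => (e u v)%:R.
Let b := adjop e' one.

Let lam0 : 0 < lam. Proof. exact: lt_le_trans lam4. Qed.

Let c0 : 0 <= (1 - beta) / 4.
Proof. by rewrite divr_ge0 // subr_ge0 ltW. Qed.

Let e'_sym : symmetric e'. Proof. exact: isolate_sym. Qed.

Lemma isolate_rayleigh (f : V -> R) :
  dot f (adjop e' f) <= beta * lam * dot f f.
Proof. by apply: rayleigh_le => //; apply: mulr_ge0 => //; apply: ltW. Qed.

(** The eigenvalue equation of [e] away from [u]. At [u] both sides vanish. *)
Lemma isolate_eigen (f : V -> R) (v : V) :
  (forall v, adjop e f v = lam * f v) ->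
  lam * (if v == u then 0 else f v) =
    f u * one v + adjop e' (fun w => if w == u then 0 else f w) v.
Proof.
move=> eig; rewrite /adjop /e' /isolate /one.
case: (eqVneq v u) => [->|vu].
  by rewrite e_irr big1 => [|w _]; rewrite ?andbF ?mul0r ?mulr0 ?addr0.
rewrite -eig /adjop (bigD1 u) //= e_sym mulrC; congr (_ + _).
rewrite [RHS](bigD1 u) //= eqxx mulr0 add0r; apply: eq_bigr => w /negPf wu.
by rewrite wu /= andbT.
Qed.

(** An eigenfunction vanishing at [u] would be one of [e'], whose quadratic form
    is too small for the eigenvalue [lam]. *)
Lemma isolate_eigen_neq0 (f : V -> R) (v : V) :
  (forall v, adjop e f v = lam * f v) -> f v != 0 -> f u != 0.
Proof.
move=> eig fv; apply/eqP => fu; pose y w := if w == u then 0 else f w.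
have yE w : adjop e' y w = lam * y w.
  by rewrite /y (isolate_eigen w eig) fu mul0r add0r.
have yv : y v != 0 by rewrite /y; case: (eqVneq v u) fv => // ->;
  rewrite fu eqxx.
have := isolate_rayleigh y; rewrite leNgt => /negP; apply.
have -> : dot y (adjop e' y) = lam * dot y y.
  by rewrite /dot mulr_sumr; apply: eq_bigr => w _; rewrite yE; ring.
by rewrite ltr_pM2r ?(dot_gt0 yv) // gtr_pMl.
Qed.

Hypothesis sum_e' : (\sum_v deg e' v = 2 * k)%N.
Hypothesis codeg_le : forall v, v != u ->
  (codeg e u v)%:R <= (1 - beta) / 4 * lam ^+ 2.

Let b_ge0 v : 0 <= b v.
Proof. by apply: sumr_ge0 => w _; rewrite mulr_ge0. Qed.

Let sum_b : \sum_v b v <= 2 * k%:R.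
Proof.
rewrite -natrM -sum_e' natr_sum; apply: ler_sum => v _.
rewrite /deg natr_sum; apply: ler_sum => w _.
by rewrite /one; case: (e u w); rewrite ?mulr1 ?mulr0.
Qed.

Let b_le v : b v <= (1 - beta) / 4 * lam ^+ 2.
Proof.
have [->|vu] := eqVneq v u.
  rewrite /b /adjop big1 => [|w _]; last first.
    by rewrite /e' /isolate eqxx andbF mul0r.
  by rewrite mulr_ge0 ?sqr_ge0.
apply: le_trans (codeg_le vu); rewrite /codeg natr_sum; apply: ler_sum => w _.
by rewrite /e' /isolate /one natrM; case: (e u w); case: (e v w);
  rewrite ?(mulr0, mul0r, mul1r, mulr1) // lern1; case: (_ && _).
Qed.

Let dot_bb : dot b b <= (1 - beta) / 4 * lam ^+ 2 * (2 * k%:R).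
Proof.
apply: (@le_trans _ _ ((1 - beta) / 4 * lam ^+ 2 * \sum_v b v)).
  by rewrite mulr_sumr; apply: ler_sum => v _; rewrite ler_wpM2r.
by rewrite ler_wpM2l // mulr_ge0 ?sqr_ge0.
Qed.

(** The squared eigenvalue is at most the number of edges, since [k] counts the
    edges away from [u]. *)
Lemma isolate_eigenvalue_le1 (f : V -> R) :
  (forall v, adjop e f v = lam * f v) -> f u = 1 ->
  lam ^+ 2 <= (deg e u)%:R + k%:R.
Proof.
move=> eig fu; pose y w := if w == u then 0 else f w.
pose z w := 1 * y w + - lam^-1 * one w.
have yE v : lam * y v = 1 * one v + 1 * adjop e' y v.
  by rewrite /y (isolate_eigen v eig) fu !mul1r.
(* The coefficients 1 keep the combinations in the shape of adjop_lin and
   dot_linr. *)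
have zE v : adjop e' z v = 1 * adjop e' y v + - lam^-1 * b v.
  exact: adjop_lin.
have lz v : lam * z v = 1 * adjop e' z v + lam^-1 * b v.
  have := yE v; rewrite zE /z => yE'.
  rewrite !mul1r mulrDr yE' mulrA mulrN divff ?gt_eqF //; ring.
have lam_y : lam = dot one y.
  rewrite -[LHS]mulr1 -fu -eig /adjop /dot; apply: eq_bigr => w _.
  by rewrite /y /one; case: (eqVneq w u) => [->|//]; rewrite e_irr !mul0r.
have dot_one : dot one one = (deg e u)%:R.
  by rewrite /deg natr_sum; apply: eq_bigr => w _; rewrite /one; case: (e u w);
    rewrite ?mulr1 ?mulr0.
have dot_oneb : dot one b <= 2 * k%:R.
  apply: le_trans sum_b; apply: ler_sum => v _; rewrite /one.
  by case: (e u v); rewrite ?mul1r ?mul0r.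
have bz : dot one (adjop e' z) = dot b z by exact: adjop_selfadj.
(* Only the codegrees of u enter beyond the first term. *)
have expand : lam ^+ 2 = (deg e u)%:R + lam^-1 * dot one b + dot b z.
  rewrite expr2 {2}lam_y.
  have -> : lam * dot one y = dot one (fun v => lam * y v).
    by rewrite /dot mulr_sumr; apply: eq_bigr => v _; ring.
  have -> : dot one (fun v => lam * y v)
    = dot one (fun v => 1 * one v + 1 * adjop e' y v).
    by apply: eq_bigr => v _; rewrite yE.
  rewrite dot_linr dot_one.
  have -> : dot one (adjop e' y)
    = dot one (fun v => 1 * adjop e' z v + lam^-1 * b v).
    by apply: eq_bigr => v _; rewrite zE; ring.
  rewrite dot_linr bz; ring.
(* As lam z = B z + b / lam and the form of B is at most beta lam, the norm of z
   is controlled by that of b. *)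
have norm_z : lam * dot z z <= beta * lam * dot z z + lam^-1 * dot b z.
  have -> : lam * dot z z = dot z (fun v => 1 * adjop e' z v + lam^-1 * b v).
    by rewrite /dot mulr_sumr; apply: eq_bigr => v _; rewrite -lz; ring.
  by rewrite dot_linr mul1r (dotC b) lerD2r isolate_rayleigh.
have CS := Cauchy_Schwarz b z.
have zz := dot_ge0 z.
have tk : dot b z <= k%:R / 2.
  have norm_z' : (1 - beta) * lam ^+ 2 * dot z z <= dot b z.
    have : lam * (lam * dot z z)
        <= lam * (beta * lam * dot z z + lam^-1 * dot b z).
      by rewrite ler_pM2l.
    rewrite mulrDr [lam * (lam^-1 * _)]mulrA divff ?gt_eqF // mul1r; lra.
  have [t0|t0] := lerP (dot b z) 0; first by
    apply: le_trans t0 _; rewrite divr_ge0.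
  rewrite -(ler_pM2l t0) -expr2; apply: le_trans CS _.
  apply: (@le_trans _ _ ((1 - beta) * lam ^+ 2 * dot z z * (k%:R / 2))).
    rewrite mulrC (_ : (1 - beta) * _ * _ * _ =
      dot z z * ((1 - beta) / 4 * lam ^+ 2 * (2 * k%:R))); last by field.
    by rewrite ler_wpM2l.
  by rewrite ler_wpM2r // divr_ge0.
have wk : lam^-1 * dot one b <= k%:R / 2.
  rewrite mulrC ler_pdivrMr //.
  have : 0 <= k%:R * (lam - 4) by rewrite mulr_ge0 // subr_ge0.
  lra.
rewrite expand; lra.
Qed.

(** Without normalisation of the eigenfunction at [u]. *)
Lemma isolate_eigenvalue_le (f : V -> R) (v : V) :
  (forall v, adjop e f v = lam * f v) -> f v != 0 ->
  lam ^+ 2 <= (deg e u)%:R + k%:R.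
Proof.
move=> eig fv; have fu := isolate_eigen_neq0 eig fv.
apply: (@isolate_eigenvalue_le1 (fun w => (f u)^-1 * f w)); last exact: mulVf.
move=> w; transitivity ((f u)^-1 * adjop e f w).
  by rewrite /adjop mulr_sumr; apply: eq_bigr => t _; ring.
by rewrite eig; ring.
Qed.

End Isolate.

(** * Many 4-cycles under a large eigenvalue *)

(** The constants: degrees are called large above 2m/5, and 50 bounds the number
    of vertices of degree above m/25. With at most 3m/5 edges left after the
    deletion of a large vertex, [closed4] is at most about 0.82 m^2 there when
    there are few 4-cycles, hence below (24/25)^4 m^2; and (1 - 24/25)/4 = 1/100 is the admissible codegree. *)
Lemma quads_lower_bound (R : realFieldType) (V : finType) (e : rel V)
  (m : nat) (lam : R) (f : V -> R) (v : V) :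
  symmetric e -> irreflexive e -> (\sum_v deg e v = 2 * m)%N ->
  (forall v, adjop e f v = lam * f v) -> f v != 0 ->
  0 <= lam -> m%:R < lam ^+ 2 -> 1000 * 1000 <= m%:R :> R ->
  m%:R ^+ 2 <= 100 * 200 * #|quads e|%:R :> R.
Proof.
move=> e_sym e_irr em eig fv lam0 mlam.
have [u _ u_max] : exists2 u, true & forall w, (deg e w <= deg e u)%N.
  by case: (arg_maxnP (deg e) (erefl (predT v))) => u _ u_max; exists u => // w;
    exact: u_max.
have hc k : (k <= m)%N -> (2 * k < (m %/ 25).+1 * 51)%N by lia.
have ee' := sum_deg_isolate u e_sym e_irr.
(* k edges remain when those at u, a vertex of maximum degree, are deleted. *)
pose k := (m - deg e u)%N; pose e' := isolate e u.
have dk : (deg e u + k = m)%N.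
  by rewrite subnKC // (deg_le_half u e_sym e_irr em).
have ek : (\sum_v deg e' v = 2 * k)%N by rewrite /e'; lia.
have k_le' : (2 * m < 5 * deg e u)%N -> (5 * k <= 3 * m)%N by lia.
move=> m_large; rewrite leNgt; apply/negP => Q_small.
have hE : 25 * (m %/ 25)%:R <= m%:R :> R.
  by rewrite -natrM ler_nat mulnC leq_trunc_div.
have h0 : 0 <= (m %/ 25)%:R :> R by [].
have Q0 : 0 <= #|quads e|%:R :> R by [].
have [d_small|d_large] := leqP (5 * deg e u) (2 * m).
- have l4 : m%:R ^+ 2 < lam ^+ 4.
    by rewrite (_ : lam ^+ 4 = (lam ^+ 2) ^+ 2) ?ltrXn2r // -?exprM ?nnegrE //.
  have := lt_le_trans l4 (eigen_closed4 e_sym fv eig).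
  have := closed4_le e_sym; rewrite -(ler_nat R).
  have := sum_sqr_deg_le e_sym em u_max (hc _ (leqnn m)); rewrite -(ler_nat R).
  move: d_small; rewrite -(ler_nat R) !(natrD, natrM, natrX).
  move: (deg e u)%:R (\sum_v _)%:R (closed4 e)%:R hE h0 Q_small Q0 m_large.
  move: (m %/ 25)%:R (#|quads e|%:R) (m%:R : R) => h Q M.
  clear em ee' ek dk => d S W hE h0 Q_small Q0 m_large d_small S_le W_le W_gt.
  have M0 : 0 <= M by lra.
  have dM : d * M <= 2 / 5 * M * M by rewrite ler_wpM2r //; lra.
  have hM : h * M <= M / 25 * M by rewrite ler_wpM2r //; lra.
  have MM : 1000 * 1000 * M <= M * M by rewrite ler_wpM2r.
  lra.
have e'_sym : symmetric e' by exact: isolate_sym.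
have e'_irr : irreflexive e' by exact: isolate_irrefl.
have k_le : 5 * k%:R <= 3 * m%:R :> R by rewrite -!natrM ler_nat k_le'.
have m1 : 0 <= m%:R :> R by [].
have W_le : (closed4 e')%:R <= (24 / 25 * lam) ^+ 4.
  have l4 : m%:R ^+ 2 <= lam ^+ 4 :> R.
    rewrite (_ : lam ^+ 4 = (lam ^+ 2) ^+ 2); last by rewrite -exprM.
    by rewrite lerXn2r ?nnegrE ?sqr_ge0 // ltW.
  have := closed4_le e'_sym; rewrite -(ler_nat R).
  have degk w := deg_le_half w e'_sym e'_irr ek.
  have km : (k <= m)%N by rewrite leq_subr.
  have := sum_sqr_deg_le e'_sym ek degk (hc _ km).
  have := quads_isolate e u.
  rewrite -!(ler_nat R) !(natrD, natrM, natrX) exprMn.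
  clear em ee' ek dk k_le'.
  move: (\sum_v _)%:R (closed4 e')%:R hE h0 Q_small Q0 m_large k_le l4.
  move: (m %/ 25)%:R (#|quads e|%:R) (m%:R : R) (#|quads e'|%:R) m1 => h Q M Q' M0.
  have kk0 : 0 <= k%:R :> R by [].
  move: k%:R (lam ^+ 4) kk0 => kk l kk0.
  move=> S W hE h0 Q_small Q0 m_large k_le l4 Q'_le S_le W_le.
  have kM : kk * kk <= (3 / 5 * M) * (3 / 5 * M) by rewrite ler_pM //; lra.
  have hM : h * kk <= M / 25 * (3 / 5 * M) by rewrite ler_pM //; lra.
  have MM : 1000 * 1000 * M <= M * M by rewrite ler_wpM2r.
  lra.
have lam4 : 4 <= lam.
  rewrite -(@ler_pXn2r _ 2) ?nnegrE //; apply: ltW; apply: le_lt_trans mlam.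
  by apply: le_trans m_large; clear; lra.
(* A codegree above m / 100 would by itself give too many labelled 4-cycles. *)
suff codeg_le w : w != u -> (codeg e u w)%:R <= (1 - 24 / 25) / 4 * lam ^+ 2.
  have b0 : (0 : R) <= 24 / 25 by clear; lra.
  have b1 : 24 / 25 < (1 : R) by clear; lra.
  have := isolate_eigenvalue_le e_sym e_irr lam4 b0 b1 W_le ek codeg_le eig fv.
  by rewrite -natrD dk leNgt mlam.
move=> wu; rewrite leNgt; apply/negP => c_large.
have uw : u != w by rewrite eq_sym.
have := codeg_quads e uw; rewrite -(ler_nat R) natrM.
have c0 : (0 < codeg e u w)%N.
  rewrite lt0n; apply/eqP => c0; move: c_large; rewrite c0 ltNge mulr_ge0 ?sqr_ge0 //.
  by clear; lra.
have : (codeg e u w)%:R = (codeg e u w).-1%:R + 1 :> R.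
  by rewrite natr1 prednK.
move: (codeg e u w)%:R ((codeg e u w).-1%:R) c_large => c c' c_large cE Q_le.
clear em ee' ek dk.
have c1 : m%:R / 100 <= c by lra.
have c2 : m%:R / 200 <= c' by lra.
have : m%:R / 100 * (m%:R / 200) <= c * c' by rewrite ler_pM //; lra.
lra.
Qed.

(** * Labelled and unlabelled 4-cycles of a graph *)

(** The oriented edges of [G]. *)
Definition edge_pairs (G : sgraph) : {set G * G} :=
  [set p | adj p.1 p.2].

Lemma card_edge_pairs (G : sgraph) :
  #|edge_pairs G| = (\sum_v deg (@adj G) v)%N.
Proof.
rewrite /deg pair_bigA -sum1_card big_mkcond; apply: eq_bigr => p _ /=.
by rewrite inE; case: ifP.
Qed.

Lemma set2_eq_pair (T : finType) (a b c d : T) :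
  [set a; b] = [set c; d] -> (a, b) = (c, d) \/ (a, b) = (d, c).
Proof.
move=> /setP E; have := E a; have := E b; have := E c; have := E d.
rewrite !inE !eqxx /= !orbT => /orP dE /orP cE /esym/orP bE /esym/orP[] /eqP aE.
  by left; subst c; case: bE => /eqP bE; [case: dE => /eqP dE|]; congruence.
by right; subst d; case: bE => /eqP bE; [|case: cE => /eqP cE]; congruence.
Qed.

(** Each edge has exactly two orientations. *)
Lemma handshake (G : sgraph) :
  (\sum_v deg (@adj G) v = 2 * #|edges G|)%N.
Proof.
rewrite -card_edge_pairs -sum1_card mulnC -sum_nat_const.
rewrite (partition_big_imset (fun p : G * G => [set p.1; p.2])) /=.
have -> : [set [set p.1; p.2] | p in edge_pairs G] = edges G.
  apply/setP => E.
  by apply/imsetP/imsetP => -[p pA ->]; exists p => //; move: pA; rewrite inE.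
apply: eq_bigr => E /imsetP[[a b] /= ab ->]; rewrite inE /= in ab.
have a_b : a != b by apply: contraTneq ab => ->; rewrite adj_irrefl.
rewrite sum1_card (_ : 2%N = #|[set (a, b); (b, a)]|); last first.
  by rewrite cards2 xpair_eqE negb_and a_b.
apply: eq_card => -[c d]; rewrite !inE /= -[in LHS]topredE /= inE /=.
apply/andP/orP => [[_ /eqP/set2_eq_pair[] ->]|].
- by left.
- by right.
by case=> /eqP [-> ->]; rewrite ?ab ?(adj_sym b) ?ab ?eqxx // finset.setUC eqxx.
Qed.

(** The labelled 4-cycle as a cyclic sequence: opposite pairs interleave. *)
Definition quad_tuple (T : Type) (q : (T * T) * (T * T)) : 4.-tuple T :=
  [tuple q.1.1; q.2.1; q.1.2; q.2.2].

Lemma quad_ucycle (G : sgraph) q :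
  q \in quads (@adj G) -> ucycleb (@adj G) (quad_tuple q).
Proof.
case: q => [[v w] [z t]]; rewrite !inE /= => /and5P[vz wz vt wt /andP[vw zt]].
have neq (a b : G) : adj a b -> a != b.
  by apply: contraTneq => ->; rewrite adj_irrefl.
rewrite /ucycleb /= !inE vz (adj_sym z) wz wt (adj_sym t) vt !negb_or vw zt.
by rewrite (neq _ _ vz) (neq _ _ vt) (neq _ _ wt) eq_sym (neq _ _ wz).
Qed.

(** The edge set of a cyclic sequence of four vertices. *)
Definition cycle_edges (T : finType) (t : 4.-tuple T) : {set {set T}} :=
  [set [set x; next t x] | x in val t].

Lemma cover_cycle_edges (T : finType) (t : 4.-tuple T) :
  finset.cover (cycle_edges t) = [set x in val t].
Proof.
apply/setP => x; rewrite inE; apply/bigcupP/idP => [[E /imsetP[y yt ->]]|xt].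
  by rewrite !inE => /orP[] /eqP -> //; rewrite mem_next.
by exists [set x; next t x]; rewrite ?set21 //; apply: imset_f.
Qed.

(** An edge set covers four vertices, so at most 4^4 labelled 4-cycles share it.
    The true multiplicity is 8, but only the order of magnitude matters. *)
Lemma quads_le_C4 (G : sgraph) :
  (#|quads (@adj G)| <= 256 * #|C4_copies G|)%N.
Proof.
rewrite -sum1_card mulnC -sum_nat_const.
rewrite (partition_big_imset (fun q => cycle_edges (quad_tuple q))) /=.
apply: (@leq_trans (\sum_(S in [set cycle_edges (quad_tuple q)
    | q in quads (@adj G)]) 256)%N); last first.
  rewrite !sum_nat_const leq_mul2r; apply/orP; right; apply: subset_leq_card.
  apply/fintype.subsetP => S /imsetP[q qQ ->].
  by apply/imsetP; exists (quad_tuple q); rewrite ?inE ?quad_ucycle.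
apply: leq_sum => S /imsetP[q _ ->]; rewrite sum1_card.
set C := [set x in val (quad_tuple q)].
have C4 : (#|C| <= 4)%N.
  by rewrite cardsE; apply: leq_trans (card_size _) _; rewrite size_tuple.
apply: (@leq_trans #|finset.setX (finset.setX C C) (finset.setX C C)|).
  apply: subset_leq_card; apply/fintype.subsetP => -[[a c] [b d]].
  rewrite -topredE /= => /andP[_ /eqP E].
  have memC x : x \in val (quad_tuple (a, c, (b, d))) -> x \in C.
    have -> : C = [set x in val (quad_tuple (a, c, (b, d)))].
      by rewrite -cover_cycle_edges E cover_cycle_edges.
    by rewrite finset.in_set.
  by rewrite !finset.in_setX !memC // !inE eqxx ?orbT.
rewrite finset.cardsX finset.cardsX.
apply: (@leq_trans ((4 * 4) * (4 * 4))%N); last by vm_compute.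
by apply: leq_mul; apply: leq_mul.
Qed.

(** A cyclic sequence a, b, c, d is determined by the oriented edges (a, b) and
    (c, d). *)
Lemma C4_le_sqr_edges (G : sgraph) :
  (#|C4_copies G| <= (2 * #|edges G|) ^ 2)%N.
Proof.
rewrite -handshake -card_edge_pairs -mulnn -cardsX.
apply: leq_trans (leq_imset_card _ _) _.
pose g (t : 4.-tuple G) := ((tnth t ord0, tnth t (inord 1)),
  (tnth t (inord 2), tnth t (inord 3))).
have g_inj : injective g.
  move=> s t [E0 E1 E2 E3]; apply: eq_from_tnth => i.
  rewrite -[i]inord_val; case: i => [[|[|[|[|//]]]] ?] //=.
  by rewrite (_ : inord 0 = ord0) //; apply: val_inj; rewrite /= inordK.
rewrite -(card_imset _ g_inj); apply: subset_leq_card.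
apply/fintype.subsetP => p /imsetP[t tC ->]; move: tC.
case: t => [[|a [|b [|c [|d [|]]]]]] //= sz; rewrite /g !(tnth_nth a) /= !inordK //.
rewrite finset.in_setX !inE /= /ucycleb /= andbT.
by move=> /andP[/and4P[-> _ -> _] _].
Qed.

(** * The spectral radius *)

(** Matrices act on rows; by symmetry left and right eigenvectors agree. *)
Lemma eigenvalue_adjacencyP (R : realType) (G : sgraph) (a : R) :
  eigenvalue (adjacency_matrix R G) a <->
  exists (f : G -> R) (v : G),
    f v != 0 /\ forall w, adjop (@adj G) f w = a * f w.
Proof.
split.
  case/eigenvalueP => x xA x0.
  have /existsP[i xi] : [exists i, x 0 i != 0].
    apply: contraNT x0 => /existsPn x0; apply/eqP/rowP => i; rewrite mxE.
    by apply/eqP; rewrite -[_ == _]negbK.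
  exists (fun v => x 0 (enum_rank v)), (enum_val i); rewrite enum_valK; split=> //.
  move=> w; have /rowP/(_ (enum_rank w)) := xA; rewrite !mxE => <-.
  rewrite /adjop (reindex _ (onW_bij _ (enum_val_bij G))); apply: eq_bigr => j _.
  by rewrite !mxE enum_valK enum_rankK mulrC adj_sym.
case=> f [v [fv eig]]; apply/eigenvalueP.
exists (\row_i f (enum_val i)).
  apply/rowP => j; rewrite !mxE -eig /adjop.
  rewrite [RHS](reindex _ (onW_bij _ (enum_val_bij G))); apply: eq_bigr => i _.
  by rewrite !mxE mulrC adj_sym.
apply: contraNneq fv => /rowP/(_ (enum_rank v)).
by rewrite !mxE enum_rankK => ->.
Qed.

Lemma roots_finite (F : fieldType) (p : {poly F}) :
  p != 0 -> exists s : seq F, forall x, root p x -> x \in s.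
Proof.
move: {2}(size p) (leqnn (size p)) => n; elim: n p => [|n IHn] p.
  by rewrite leqn0 size_poly_eq0 => ->.
move=> sz p0; have [[x px]|no_root] := pselect (exists x, root p x); last first.
  by exists [::] => x px; case: no_root; exists x.
have [q pE] := factor_theorem p x px.
have q0 : q != 0 by apply: contraNneq p0 => q0; rewrite pE q0 mul0r.
have [|s sP] := IHn q _ q0.
  by move: sz; rewrite pE size_Mmonic ?monicXsubC // size_XsubC addn2.
exists (x :: s) => y; rewrite pE rootM root_XsubC inE orbC.
by case/orP => [->//|/sP ->]; rewrite orbT.
Qed.

(** A maximum over those elements of [s] that satisfy [P]. *)
Lemma seq_max (R : realFieldType) (s : seq R) (P : pred R) a :
  a \in s -> P a ->
  exists b, [/\ b \in s, P b & forall x, x \in s -> P x -> x <= b].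
Proof.
elim: s a => // c s IHs a; rewrite inE => a_in Pa.
have [[d [ds Pd]]|no_d] := pselect (exists d, d \in s /\ P d); last first.
  case/orP: a_in => [/eqP ac|as_]; last by case: no_d; exists a.
  subst c; exists a; rewrite mem_head; split=> // x.
  by rewrite inE => /orP[/eqP -> //|xs Px]; case: no_d; exists x.
have [b [bs Pb b_max]] := IHs d ds Pd.
have [Pc|nPc] := boolP (P c); last first.
  exists b; rewrite inE bs orbT; split=> // x.
  by rewrite inE => /orP[/eqP -> Pc|]; [rewrite Pc in nPc|exact: b_max].
have [cb|/ltW bc] := lerP c b.
  exists b; rewrite inE bs orbT; split=> // x.
  by rewrite inE => /orP[/eqP -> //|]; exact: b_max.
exists c; rewrite mem_head; split=> // x.
rewrite inE => /orP[/eqP -> //|xs Px]; apply: le_trans bc; exact: b_max.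
Qed.

(** The eigenvalues are the roots of the characteristic polynomial, hence
    finitely many, so a largest one exists as soon as there is one. *)
Lemma spectral_radius_ge (R : realType) (G : sgraph) (a : R) :
  eigenvalue (adjacency_matrix R G) a -> a <= spectral_radius R G.
Proof.
move=> a_eig; set A := adjacency_matrix R G in a_eig *.
have [s sP] := roots_finite (monic_neq0 (char_poly_monic A)).
have [|b [_ b_eig b_max]] := seq_max _ a_eig (s := s).
  by apply: sP; rewrite -eigenvalue_root_char.
suff [_ ->//] : is_largest_eigenvalue A (spectral_radius R G).
apply: (@xgetPex _ 0 [set x | is_largest_eigenvalue A x]%classic).
exists b; split=> // x x_eig; apply: b_max => //.
by apply: sP; rewrite -eigenvalue_root_char.
Qed.

(** A nonzero value is not the default value of the spectral radius. *)
Lemma spectral_radius_eigen (R : realType) (G : sgraph) :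
  spectral_radius R G != 0 ->
  eigenvalue (adjacency_matrix R G) (spectral_radius R G).
Proof.
rewrite /spectral_radius.
by case: xgetP => [x -> [] //|_]; rewrite eqxx.
Qed.

(** * Graphs with m edges and large spectral radius *)

(** The disjoint union of a clique on ['I_k] and of [r] edges, the two ends of
    each being indexed by a boolean. *)
Definition clique_matching_adj (k r : nat) : rel ('I_k + 'I_r * bool) :=
  fun x y => match x, y with
  | inl i, inl j => i != j
  | inr p, inr q => (p.1 == q.1) && (p.2 != q.2)
  | _, _ => false
  end.

Lemma clique_matching_sym k r : symmetric (@clique_matching_adj k r).
Proof.
by case=> [i|p] [j|q] //=; rewrite 1?eq_sym // [p.2 == _]eq_sym.
Qed.

Lemma clique_matching_irrefl k r : irreflexive (@clique_matching_adj k r).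
Proof. by case=> [i|p] /=; rewrite !eqxx. Qed.

Definition clique_matching (k r : nat) : sgraph :=
  SGraph (@clique_matching_sym k r) (@clique_matching_irrefl k r).

Lemma clique_matching_edges k r :
  (2 * #|edges (clique_matching k r)| = k * k.-1 + 2 * r)%N.
Proof.
rewrite -handshake /deg big_sumType /=; congr (_ + _)%N.
  transitivity (\sum_(i < k) k.-1)%N; last by rewrite sum_nat_const card_ord.
  apply: eq_bigr => i _; rewrite big_sumType /= [X in (_ + X)%N]big1 // addn0.
  transitivity (\sum_(j < k | j != i) 1)%N.
    by rewrite [RHS]big_mkcond; apply: eq_bigr => j _; rewrite eq_sym; case: eqP.
  by rewrite sum1_card cardC1 card_ord.
transitivity (\sum_(p : 'I_r * bool) 1)%N; last first.
  by rewrite sum1_card card_prod card_ord card_bool mulnC.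
apply: eq_bigr => p _; rewrite big_sumType /= [X in (X + _)%N]big1 // add0n.
rewrite (bigD1 (p.1, ~~ p.2)) //= eqxx big1 => [|q]; first by case: p.2.
case: p q => [i b] [j c]; rewrite xpair_eqE /= [i == j]eq_sym.
by case: (j == i); case: b; case: c.
Qed.

(** The indicator function of the clique is an eigenfunction. *)
Lemma clique_matching_radius (R : realType) k r : (0 < k)%N ->
  k.-1%:R <= spectral_radius R (clique_matching k r).
Proof.
case: k => // k _; apply: spectral_radius_ge; apply/eigenvalue_adjacencyP.
pose f (v : clique_matching k.+1 r) : R := (if v is inl _ then true else false)%:R.
exists f, (inl ord0); split; first by rewrite oner_eq0.
case=> [i|p]; rewrite /adjop big_sumType /= [X in _ + X]big1.
- rewrite addr0 mulr1; under eq_bigr do rewrite mulr1.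
  rewrite -natr_sum; congr _%:R; transitivity (\sum_(j < k.+1 | j != i) 1)%N.
    by rewrite [RHS]big_mkcond; apply: eq_bigr => j _; rewrite eq_sym; case: eqP.
  by rewrite sum1_card cardC1 card_ord.
- by move=> q _; rewrite mul0r.
- by rewrite big1 ?addr0 ?mulr0 // => q _; rewrite mul0r.
- by move=> q _; rewrite mulr0.
Qed.

(** Every number of edges is that of a clique on [k] vertices plus fewer than
    [k] further edges. *)
Lemma bin2_floor (m : nat) :
  exists k r, (2 * m = k * k.-1 + 2 * r)%N /\ (r < k)%N.
Proof.
elim: m => [|m [k [r [E rk]]]]; first by exists 1%N, 0%N.
have [rk'|] := ltnP r.+1 k; first by exists k, r.+1; split=> //; lia.
move=> kr; exists k.+1, 0%N; split=> //=; have -> : k = r.+1 by lia.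
move: E; have -> : k = r.+1 by lia.
by move=> /=; lia.
Qed.

Lemma C4_count_attained_ex (R : realType) (m : nat) : (10 <= m)%N ->
  exists k, C4_count_attained R m k.
Proof.
move=> m10; have [k [r [E rk]]] := bin2_floor m.
exists #|C4_copies (clique_matching k r)|, (clique_matching k r).
have k5 : (5 <= k)%N by rewrite leqNgt; apply/negP => ?; nia.
split=> //.
  by have := clique_matching_edges k r; lia.
apply: lt_le_trans (clique_matching_radius R r (leq_trans _ k5)) => //.
rewrite -(@ltr_pXn2r _ 2) ?nnegrE ?sqrtr_ge0 // sqr_sqrtr // -natrX ltr_nat.
case: k k5 rk E => //= k; nia.
Qed.

(** The minimum is over a nonempty set, so it is not the default value. *)
Lemma min_C4_count_attained (R : realType) (m : nat) : (10 <= m)%N ->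
  C4_count_attained R m (min_C4_count R m).
Proof.
move=> m10; have [k kP] := C4_count_attained_ex R m10.
pose P j := `[< C4_count_attained R m j >].
have exP : exists j, P j by exists k; apply/asboolP.
case: (ex_minnP exP) => j /asboolP jP j_min.
have : exists i, C4_count_attained R m i /\
    forall l, C4_count_attained R m l -> (i <= l)%N.
  by exists j; split=> // l lP; apply: j_min; apply/asboolP.
by move=> ex; have [] := @xgetPex _ 0%N [set i | C4_count_attained R m i /\
    forall l, C4_count_attained R m l -> (i <= l)%N]%classic ex.
Qed.

(** * The order of magnitude *)

Theorem mainTheorem2 (R : realType) :
  exists (c C : R) (m0 : nat),
    [/\ 0 < c, 0 < C &
      forall m : nat, (m0 <= m)%N ->
        c * m%:R ^+ 2 <= (min_C4_count R m)%:R <= C * m%:R ^+ 2].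
Proof.
exists (100 * 200 * 256)^-1, 4, (1000 * 1000)%N.
split; rewrite ?invr_gt0 // ?mulr_gt0 // => m m_large.
have m10 : (10 <= m)%N by apply: leq_trans m_large; apply: (@leq_mul 10 1).
have [G [Gm Grad <-]] := min_C4_count_attained R m10.
apply/andP; split; last first.
  have -> : (4 : R) = 2 ^+ 2 by rewrite expr2 -natrM.
  by rewrite -exprMn -natrM -natrX ler_nat -Gm C4_le_sqr_edges.
have rad0 : 0 < spectral_radius R G by apply: le_lt_trans Grad; apply: sqrtr_ge0.
have /eigenvalue_adjacencyP[f [v [fv eig]]] :=
  spectral_radius_eigen (lt0r_neq0 rad0).
have mlam : m%:R < spectral_radius R G ^+ 2.
  by rewrite -[ltLHS]sqr_sqrtr // ltrXn2r ?nnegrE ?sqrtr_ge0 ?ltW.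
have sum_deg : (\sum_v deg (@adj G) v = 2 * m)%N by rewrite handshake Gm.
have m_large' : 1000 * 1000 <= m%:R :> R by rewrite -natrM ler_nat.
have Q_ge := quads_lower_bound (@adj_sym G) (@adj_irrefl G) sum_deg eig fv
  (ltW rad0) mlam m_large'.
rewrite mulrC ler_pdivrMr ?mulr_gt0 //; apply: le_trans Q_ge _.
rewrite [leRHS]mulrC -[leRHS]mulrA ler_pM2l ?mulr_gt0 // -natrM ler_nat.
exact: quads_le_C4.
Qed.
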